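(* Suppose $(X,d)$ is a length space and suppose $(X_m,d_m)$, $m\in\mathbb{N}$, form a sequence of $C$-rCAT$(0)$ spaces. Write $\widetilde{C}=3C+2\sqrt{3}$. Then the following hold. (a) If $(X,d)$ is a (pointed or unpointed) Gromov-Hausdorff limit of $(X_m,d_m)$, then $(X,d)$ is a $\widetilde{C}$-rCAT$(0)$ space. (b) If $(X,d)$ is an ultralimit of $(X_m,d_m)$, then $(X,d)$ is a $\widetilde{C}$-rCAT$(0)$ space. (c) If $(X,d)$ is rCAT$(0)$ (that is, $C_1$-rCAT$(0)$ for some $C_1>0$), then the asymptotic cone $\mathrm{Cone}_\omega X:=\lim_\omega (X,d/m)$ is a CAT$(0)$ space for every non-principal ultrafilter $\omega$ on $\mathbb{N}$.
   Context: $\mathbb{R}^2$ carries the Euclidean metric $|\cdot-\cdot|$. Gromov-Hausdorff limits are understood in the usual sense. Short segments. Let $(X,d)$ be a metric space and $h\ge 0$. An $h$-short segment in $X$ is a path $\gamma:[0,L]\to X$, $L\ge 0$, with $\mathrm{len}(\gamma)\ge d(\gamma(0),\gamma(L))\ge \mathrm{len}(\gamma)-h$, where $\mathrm{len}$ is path length. $[x,y]_h$ denotes an $h$-short segment from $x$ to $y$ (and also its image). For a point $z=\gamma(t)$ of such a path, $[x,z]_h$ and $[z,y]_h$ denote the subpaths $\gamma|_{[0,t]}$ and $\gamma|_{[t,L]}$. A geodesic segment $[x,y]$ is a $0$-short segment. $(X,d)$ is a length space if for every $x,y\in X$ and every $h>0$ there is an $h$-short segment $[x,y]_h$; it is geodesic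 if every two points are joined by a geodesic segment. Triangles. An $h$-short triangle $T_h(x_1,x_2,x_3)$ with vertices $x_1,x_2,x_3\in X$ is a collection of $h$-short segments $[x_1,x_2]_h,[x_2,x_3]_h,[x_3,x_1]_h$ (its sides). A comparison triangle is a Euclidean triangle $T(\bar x_1,\bar x_2,\bar x_3)$ in $\mathbb{R}^2$ with $|\bar x_i-\bar x_j|=d(x_i,x_j)$ for $i,j\in\{1,2,3\}$. A point $\bar u\in[\bar x_i,\bar x_j]$ is a comparison point for $u\in[x_i,x_j]_h$ if $|\bar x_i-\bar u|\le \mathrm{len}([x_i,u]_h)$ and $|\bar u-\bar x_j|\le \mathrm{len}([u,x_j]_h)$. A geodesic triangle is a $0$-short triangle (then the comparison point is determined by $|\bar x_i-\bar u|=d(x_i,u)$). CAT(0). A geodesic space $(X,d)$ is CAT$(0)$ if for every geodesic triangle $T(x,y,z)$ with comparison triangle $T(\bar x,\bar y,\bar z)$ and any $u\in[x,y]$, $v\in[x,z]$, we have $d(u,v)\le|\bar u-\bar v|$, where $\bar u,\bar v$ are the comparison points for $u,v$. Rough CAT(0). Given $C>0$, a length space $(X,d)$ is $C$-rCAT$(0)$ if $d(u,v)\le|\bar u-\bar v|+C$ whenever $x,y,z\in X$, $T=T_h(x,y,z)$ is an $h$-short triangle with $h=1/\max\{1,d(x,y),d(x,z),d(y,z)\}$, $\bar T=T(\bar x,\bar y,\bar z)$ is a comparison triangle in $\mathbb{R}^2$ for $T$, $u,v$ lie on different sides of $T$, and $\bar u,\bar v\in\bar T$ are comparison points for $u,v$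 respectively. Ultralimits. Given a non-principal ultrafilter $\omega$ on $\mathbb{N}$ and metric spaces $(X_m,d_m)$ with basepoints $p_m\in X_m$, the ultralimit $\lim_\omega(X_m,d_m)$ is the metric space of equivalence classes of sequences $(x_m)$, $x_m\in X_m$, with $d_m(x_m,p_m)$ bounded, with distance $\lim_\omega d_m(x_m,y_m)$, where sequences at distance $0$ are identified. The asymptotic cone $\mathrm{Cone}_\omega X$ is the ultralimit of the spaces $(X,d/m)$, $m\ge1$, taken with a constant sequence of basepoints. *)

(* Defs.v *)
From HB Require Import structures.
From mathcomp Require Import all_boot all_order all_algebra.
From mathcomp Require Import all_classical all_reals all_analysis.

Set Implicit Arguments.
Unset Strict Implicit.
Unset Printing Implicit Defensive.

Import Order.TTheory GRing.Theory Num.Theory.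
Import numFieldNormedType.Exports.

Local Open Scope classical_set_scope.
Local Open Scope ring_scope.
Local Open Scope quotient_scope.

Section Curves.
Context {R : realType} {X : metricType R}.
Implicit Types (f : R -> X) (a b h t : R) (x y : X).

Definition polygonal_length f a b (s : seq R) : R :=
  \sum_(0 <= n < size s)
    mdist (f (nth b (a :: s) n)) (f (nth b s n)).

Definition path_length f a b : \bar R :=
  ereal_sup [set (polygonal_length f a b s)%:E | s in itv_partition a b].

(* A path [0, L] -> X: the values of [curve_fun] outside [0, L] are junk. *)
Record curve := Curve {
  curve_end : R ;
  curve_fun :> R -> X ;
  curve_end_ge0 : 0 <= curve_end ;
  curve_continuous : {within `[0, curve_end], continuous curve_fun} }.

Implicit Type g : curve.

Definition curve_length g : \bar R := path_length g 0 (curve_end g).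

Definition joins g x y := g 0 = x /\ g (curve_end g) = y.

Definition short h g :=
  (curve_length g - h%:E <= (mdist (g 0) (g (curve_end g)))%:E
     <= curve_length g)%E.

End Curves.
Arguments curve {R} X.

Section Spaces.
Context {R : realType}.
Implicit Types (X : metricType R).

Definition length_space X := forall (x y : X) (h : R), 0 < h ->
  exists g : curve X, short h g /\ joins g x y.

Definition geodesic_space X := forall x y : X,
  exists g : curve X, short 0 g /\ joins g x y.

End Spaces.

(* The library's norm on 'rV[R]_n is the sup norm, hence the following. *)
Definition eucl_dist {R : realType} {n : nat} (u v : 'rV[R]_n) : R :=
  Num.sqrt (\sum_i (u 0 i - v 0 i) ^+ 2).

Definition eucl_segment {R : realType} {n : nat} (u v : 'rV[R]_n) : set 'rV[R]_n :=
  [set (1 - t) *: u + t *: v | t in `[0, 1]].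

(* Vertices and sides of a triangle are indexed by 'I_3: side [i] runs from
   vertex [i] to its cyclic successor [ordS i]. *)
Section Triangles.
Context {R : realType} {X : metricType R}.
Implicit Types (h t : R) (x : 'I_3 -> X) (g : 'I_3 -> curve X)
  (xb : 'I_3 -> 'rV[R]_2) (i : 'I_3).

Definition short_triangle h x g :=
  forall i, short h (g i) /\ joins (g i) (x i) (x (ordS i)).

Definition comparison_triangle x xb :=
  forall i j, eucl_dist (xb i) (xb j) = mdist (x i) (x j).

(* [ub] is a comparison point for the point [g i t] of side [i]. *)
Definition comparison_point g xb i t (ub : 'rV[R]_2) :=
  [/\ eucl_segment (xb i) (xb (ordS i)) ub,
      ((eucl_dist (xb i) ub)%:E <= path_length (g i) 0 t)%E &
      ((eucl_dist ub (xb (ordS i)))%:E <= path_length (g i) t (curve_end (g i)))%E].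

Definition triangle_shortness x : R :=
  (\big[Num.max/1]_(i < 3) mdist (x i) (x (ordS i)))^-1.

End Triangles.

Section CAT0.
Context {R : realType}.
Implicit Types (X : metricType R).

(* [x 0], [x 1], [x 2] are the vertices x, y, z, so that side 0 is [x, y] and
   side 2 is [x, z], parametrised from z to x. *)
Definition CAT0 X := geodesic_space X /\
  forall (x : 'I_3 -> X) (g : 'I_3 -> curve X) (xb : 'I_3 -> 'rV[R]_2)
         (s t : R) (ub vb : 'rV[R]_2),
    short_triangle 0 x g -> comparison_triangle x xb ->
    s \in `[0, curve_end (g 0)] -> t \in `[0, curve_end (g 2)] ->
    comparison_point g xb 0 s ub -> comparison_point g xb 2 t vb ->
    mdist (g 0 s) (g 2 t) <= eucl_dist ub vb.

Definition rCAT0 (C : R) X := length_space X /\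
  forall (x : 'I_3 -> X) (g : 'I_3 -> curve X) (xb : 'I_3 -> 'rV[R]_2)
         (i j : 'I_3) (s t : R) (ub vb : 'rV[R]_2),
    short_triangle (triangle_shortness x) x g -> comparison_triangle x xb ->
    i != j ->
    s \in `[0, curve_end (g i)] -> t \in `[0, curve_end (g j)] ->
    comparison_point g xb i s ub -> comparison_point g xb j t vb ->
    mdist (g i s) (g j t) <= eucl_dist ub vb + C.

End CAT0.

Section GromovHausdorff.
Context {R : realType}.
Implicit Types (X Y Z : metricType R).

Definition isometric_embedding X Y (f : X -> Y) :=
  forall x x', mdist (f x) (f x') = mdist x x'.

Definition isometric X Y :=
  exists f : X -> Y, isometric_embedding f /\ set_surj setT setT f.

Definition hausdorff_dist Z (A B : set Z) : \bar R :=
  ereal_inf [set r%:E | r in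
    [set r : R | [/\ 0 < r, A `<=` \bigcup_(b in B) ball b r &
                   B `<=` \bigcup_(a in A) ball a r]]].

Definition gh_dist X Y : \bar R :=
  ereal_inf [set e | exists (Z : metricType R) (f : X -> Z) (g : Y -> Z),
    [/\ isometric_embedding f, isometric_embedding g &
        e = hausdorff_dist (range f) (range g)]].

Definition gh_limit (X_ : nat -> metricType R) X :=
  gh_dist (X_ m) X @[m --> \oo] --> (0%:E : \bar R).

(* Burago-Burago-Ivanov, A Course in Metric Geometry, Definition 8.1.1; only
   the values of [f] on the ball of radius [r] matter. *)
Definition pointed_gh_limit (X_ : nat -> metricType R) (p_ : forall m, X_ m)
    X (p : X) :=
  forall r e : R, 0 < r -> 0 < e -> \forall m \near \oo,
    exists f : X_ m -> X,
      [/\ f (p_ m) = p,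
          forall x x', ball (p_ m) r x -> ball (p_ m) r x' ->
            `|mdist (f x) (f x') - mdist x x'| < e &
          ball p (r - e) `<=`
            \bigcup_(x in ball (p_ m) r) ball (f x) e].

End GromovHausdorff.

Definition nonprincipal (w : set_system nat) :=
  forall n, w <> principal_filter n.

Section Ultralimit.
Context {R : realType} (w : set_system nat) (w_ultra : UltraFilter w).
Context {X_ : nat -> metricType R} (p : forall m, X_ m).

Record bounded_seq := BoundedSeq {
  bseq :> forall m, X_ m ;
  bseq_bounded : exists B : R, forall m, mdist (bseq m) (p m) <= B }.

HB.instance Definition _ := gen_eqMixin bounded_seq.
HB.instance Definition _ := gen_choiceMixin bounded_seq.

Definition seq_dist (x y : forall m, X_ m) : R :=
  lim (mdist (x m) (y m) @[m --> w]).

Lemma seq_dist_is_cvg (x y : bounded_seq) :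
  cvg (mdist (x m) (y m) @[m --> w]).
Proof.
have [B xB] := bseq_bounded x; have [B' yB'] := bseq_bounded y.
have bnd m : `[0, B + B']%classic (mdist (x m) (y m)).
  rewrite /= in_itv/= mdist_ge0 (le_trans (metric_triangle _ (p m) _))//.
  by rewrite lerD// metric_sym.
have Fp : ProperFilter (mdist (x m) (y m) @[m --> w]) by exact: fmap_proper_filter.
have := @segment_compact R 0 (B + B') _ Fp.
case; first by exact: nearW.
move=> l [_ cl]; apply/cvg_ex; exists l => N Nl.
have [//|wN] := in_ultra_setVsetC ((fun m => mdist (x m) (y m)) @^-1` N) w_ultra.
have [r [/= Nr nNr]] := cl (~` N) N wN Nl.
by [].
Qed.

Lemma seq_dist_xx (x : bounded_seq) : seq_dist x x = 0.
Proof.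
rewrite /seq_dist; under eq_fun do rewrite mdistxx.
exact: lim_cst.
Qed.

Lemma seq_dist_sym (x y : bounded_seq) : seq_dist x y = seq_dist y x.
Proof. by rewrite /seq_dist; under eq_fun do rewrite metric_sym. Qed.

Lemma seq_dist_ge0 (x y : bounded_seq) : 0 <= seq_dist x y.
Proof.
apply: limr_ge; first exact: seq_dist_is_cvg.
by apply: nearW => m; exact: mdist_ge0.
Qed.

Lemma seq_dist_triangle (y x z : bounded_seq) :
  seq_dist x z <= seq_dist x y + seq_dist y z.
Proof.
rewrite /seq_dist -limD; try exact: seq_dist_is_cvg.
apply: ler_lim; first exact: seq_dist_is_cvg.
  by apply: is_cvgD; exact: seq_dist_is_cvg.
by apply: nearW => m; exact: metric_triangle.
Qed.

Definition seq_equiv (x y : bounded_seq) : bool := seq_dist x y == 0.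

Lemma seq_equiv_refl : reflexive seq_equiv.
Proof. by move=> x; rewrite /seq_equiv seq_dist_xx. Qed.

Lemma seq_equiv_sym : symmetric seq_equiv.
Proof. by move=> x y; rewrite /seq_equiv seq_dist_sym. Qed.

Lemma seq_equiv_trans : transitive seq_equiv.
Proof.
move=> y x z /eqP xy /eqP yz; rewrite /seq_equiv eq_le seq_dist_ge0 andbT.
by rewrite (le_trans (seq_dist_triangle y x z))// xy yz addr0.
Qed.

Canonical seq_equiv_rel :=
  EquivRel seq_equiv seq_equiv_refl seq_equiv_sym seq_equiv_trans.

Definition ultralimit : Type := {eq_quot seq_equiv_rel}.
HB.instance Definition _ := Choice.on ultralimit.
HB.instance Definition _ := EqQuotient.on ultralimit.

Definition ultralimit_dist (x y : ultralimit) : R :=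
  seq_dist (repr x) (repr y).

Lemma ultralimit_distxx x : ultralimit_dist x x = 0.
Proof. exact: seq_dist_xx. Qed.

Lemma ultralimit_dist_positivity x y : ultralimit_dist x y = 0 -> x = y.
Proof. by move=> /eqP xy; rewrite -[x]reprK -[y]reprK; apply/eqmodP. Qed.

Lemma ultralimit_dist_sym x y : ultralimit_dist x y = ultralimit_dist y x.
Proof. exact: seq_dist_sym. Qed.

Lemma ultralimit_dist_triangle y x z :
  ultralimit_dist x z <= ultralimit_dist x y + ultralimit_dist y z.
Proof. exact: seq_dist_triangle. Qed.

HB.instance Definition _ := @isMetric.Build R ultralimit ultralimit_dist
  ultralimit_distxx ultralimit_dist_positivity ultralimit_dist_sym
  ultralimit_dist_triangle.

Lemma ultralimit_distE (x y : bounded_seq) :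
  mdist (\pi_ultralimit x) (\pi_ultralimit y) = seq_dist x y.
Proof.
have e (z : bounded_seq) : seq_dist (repr (\pi_ultralimit z)) z = 0.
  by apply/eqP; rewrite -[_ == 0]/(seq_equiv_rel _ _); apply/eqmodP; rewrite reprK.
change (seq_dist (repr (\pi_ultralimit x)) (repr (\pi_ultralimit y)) = seq_dist x y).
apply/eqP; rewrite eq_le; apply/andP; split.
- rewrite (le_trans (seq_dist_triangle x _ _))// e add0r.
  by rewrite (le_trans (seq_dist_triangle y _ _))// (seq_dist_sym y) e addr0.
- rewrite (le_trans (seq_dist_triangle (repr (\pi_ultralimit x)) _ _))//.
  rewrite (seq_dist_sym x) e add0r.
  by rewrite (le_trans (seq_dist_triangle (repr (\pi_ultralimit y)) _ _))// e addr0.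
Qed.

End Ultralimit.

(* The metric space (X, c d). *)
Definition rescaled {R : realType} (c : {posnum R}) (X : metricType R) : Type :=
  X.

Section Rescaled.
Context {R : realType} (c : {posnum R}) (X : metricType R).

HB.instance Definition _ := Choice.copy (rescaled c X) X.

Definition rescaled_dist (x y : rescaled c X) : R := c%:num * @mdist R X x y.

Lemma rescaled_distxx x : rescaled_dist x x = 0.
Proof. by rewrite /rescaled_dist mdistxx mulr0. Qed.

Lemma rescaled_dist_positivity x y : rescaled_dist x y = 0 -> x = y.
Proof.
by move=> /eqP; rewrite mulf_eq0 gt_eqF//= => /eqP /mdist_positivity.
Qed.

Lemma rescaled_dist_sym x y : rescaled_dist x y = rescaled_dist y x.
Proof. by rewrite /rescaled_dist metric_sym. Qed.

Lemma rescaled_dist_triangle y x z :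
  rescaled_dist x z <= rescaled_dist x y + rescaled_dist y z.
Proof. by rewrite /rescaled_dist -mulrDr ler_pM2l// metric_triangle. Qed.

HB.instance Definition _ := @isMetric.Build R (rescaled c X) rescaled_dist
  rescaled_distxx rescaled_dist_positivity rescaled_dist_sym
  rescaled_dist_triangle.

End Rescaled.

Lemma cone_scale_subproof {R : realType} (m : nat) :
  0 < ((maxn m 1)%:R : R)^-1.
Proof. by rewrite invr_gt0 ltr0n leq_max orbT. Qed.

(* 1 / m for m >= 1; the value at 0 is junk, and does not matter since {0} does
   not belong to a non-principal ultrafilter. *)
Definition cone_scale {R : realType} (m : nat) : {posnum R} :=
  PosNum (cone_scale_subproof m).

Definition asymptotic_cone {R : realType} (w : set_system nat)
    (w_ultra : UltraFilter w) (X : metricType R) (p : X) : metricType R :=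
  @ultralimit R w w_ultra (fun m => rescaled (cone_scale m) X) (fun=> p).

(* Main.v *)
Require Import Defs.
From mathcomp Require Import all_boot all_order all_algebra.
From mathcomp Require Import all_classical all_reals all_analysis.
From mathcomp Require Import ring lra.

(** In a C-rCAT(0) space, compare a point u with the point w at relative
    position s on a very short side [x_i, x_(i+1)]: the thin triangle
    (x_i, x_(i+1), u) gives d(u, w) <= C + (Stewart's length of the cevian), and
    comparing w with its analogue on another side of (x_0, x_1, x_2) costs a
    third C. The result, [five_point (3 * C)], is a closed condition on the
    distances between five points, so it passes to limits, and the limit of
    spaces rescaled by 1/m satisfies [five_point 0]. Conversely, if u lies on an
    h-short side of length c with c h <= 1 and h <= 1, the Stewart term is at most
    sqrt (c h / 2 + h^2) <= sqrt 3, which gives the constant 3 C + 2 sqrt 3. *)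

Set Implicit Arguments.
Unset Strict Implicit.
Unset Printing Implicit Defensive.

Import Order.TTheory GRing.Theory Num.Theory.
Import numFieldNormedType.Exports.

Local Open Scope classical_set_scope.
Local Open Scope ring_scope.

(** * Lengths of paths and short curves *)

Section Length.
Context {R : realType} {X : metricType R}.
Implicit Types (f : R -> X) (a b c h t : R) (g : curve X).

Lemma polygonal_length_nil f a b : polygonal_length f a b [::] = 0.
Proof. by rewrite /polygonal_length big_geq. Qed.

Lemma polygonal_length_cons f a b c (s : seq R) :
  polygonal_length f a b (c :: s) = mdist (f a) (f c) + polygonal_length f c b s.
Proof. by rewrite /polygonal_length big_nat_recl. Qed.

Lemma polygonal_length_cat f a b c (s1 s2 : seq R) : last a s1 = c ->
  polygonal_length f a b (s1 ++ s2) =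
  polygonal_length f a c s1 + polygonal_length f c b s2.
Proof.
move=> <-; elim: s1 a => [|x s1 IH] a /=.
  by rewrite polygonal_length_nil add0r.
by rewrite !polygonal_length_cons IH addrA.
Qed.

Lemma mdist_le_path_length f a b : a <= b ->
  ((mdist (f a) (f b))%:E <= path_length f a b)%E.
Proof.
rewrite le_eqVlt => /predU1P[<-|ab]; apply: ereal_sup_ubound.
  exists [::]; first by split.
  by rewrite polygonal_length_nil mdistxx.
exists [:: b]; first by split; rewrite //= ab.
by rewrite polygonal_length_cons polygonal_length_nil addr0.
Qed.

Lemma path_length_ge0 f a b : a <= b -> (0 <= path_length f a b)%E.
Proof.
move=> ab; apply: le_trans (mdist_le_path_length f ab).
by rewrite lee_fin mdist_ge0.
Qed.

Lemma itv_partition_exists a b : a <= b -> exists s, itv_partition a b s.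
Proof.
rewrite le_eqVlt => /predU1P[<-|ab]; first by exists [::]; split.
by exists [:: b]; exact: itv_partition1.
Qed.

(** Concatenating a partition of [[a, b]] with one of [[b, c]] gives a partition of [[a, c]], and
    polygonal lengths add up. Suprema are then taken over the second partition first. *)
Lemma path_length_cat f a b c : a <= b -> b <= c ->
  (path_length f a b + path_length f b c <= path_length f a c)%E.
Proof.
move=> ab bc.
have cat_le s1 : itv_partition a b s1 ->
    ((polygonal_length f a b s1)%:E + path_length f b c <= path_length f a c)%E.
  move=> p1; rewrite -leeBrDl//; apply: ge_ereal_sup => _ [s2 p2 <-].
  rewrite leeBrDl//; apply: ereal_sup_ubound; exists (s1 ++ s2).
    exact: itv_partition_cat p1 p2.
  by case: p1 => _ /eqP /polygonal_length_cat ->.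
have := path_length_ge0 f bc.
(* Moving this length to the other side requires it to be finite. If it is infinite, any one
   partition of [[a, b]] already forces the total to be infinite. *)
case: (path_length f b c) cat_le => [r| |] cat_le // _.
- rewrite -leeBrDr//; apply: ge_ereal_sup => _ [s1 p1 <-].
  by rewrite leeBrDr//; exact: cat_le.
- by have [s1 /cat_le] := itv_partition_exists ab; rewrite addey// leye_eq => /eqP ->;
    rewrite leey.
Qed.

Lemma short_le h h' g : h <= h' -> short h g -> short h' g.
Proof.
move=> hh' /andP[gh gd]; rewrite /short gd andbT (le_trans _ gh)//.
by rewrite leeB// lee_fin.
Qed.

(** Superadditivity of length turns lower bounds on the two subpath lengths into a bound by the
    distance of the endpoints, up to the defect [h]. *)
Lemma short_split h g t (p q : R) : short h g -> t \in `[0, curve_end g] ->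
  (p%:E <= path_length g 0 t)%E -> (q%:E <= path_length g t (curve_end g))%E ->
  p + q <= mdist (g 0) (g (curve_end g)) + h.
Proof.
rewrite in_itv/= => /andP[gh _] /andP[t0 tL] pl ql.
rewrite -lee_fin !EFinD -leeBlDr//; apply: le_trans gh; apply: leeB => //.
exact: le_trans (leeD pl ql) (path_length_cat _ t0 tL).
Qed.

Lemma short_mdist3 h g (s t : R) : short h g -> 0 <= s -> s <= t -> t <= curve_end g ->
  mdist (g 0) (g s) + mdist (g s) (g t) + mdist (g t) (g (curve_end g)) <=
  mdist (g 0) (g (curve_end g)) + h.
Proof.
move=> gh s0 st tL; apply: (short_split gh (t := t)).
- by rewrite in_itv/= tL (le_trans s0 st).
- apply: le_trans (path_length_cat _ s0 st).
  by rewrite EFinD leeD// mdist_le_path_length.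
- exact: mdist_le_path_length.
Qed.

Lemma mdist_continuous (x : X) : continuous (mdist x : X -> R).
Proof.
move=> y; apply/cvgrPdist_lt => e e0.
have /metricType_numDomainType.cvgr_dist_lt/(_ _ e0) : id @ y --> y by exact: cvg_id.
apply: filterS => z; apply: le_lt_trans.
have := metric_triangle x y z; have := metric_triangle x z y.
rewrite (metric_sym z y) => xy xz.
by rewrite ler_norml; lra.
Qed.

Lemma curve_ivt g (d : R) : 0 <= d <= mdist (g 0) (g (curve_end g)) ->
  exists2 s, s \in `[0, curve_end g] & mdist (g 0) (g s) = d.
Proof.
move=> dd; apply: IVT; first exact: curve_end_ge0.
  move=> s; apply: continuous_comp; first exact: curve_continuous.
  exact: mdist_continuous.
by rewrite mdistxx min_l ?max_r ?mdist_ge0.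
Qed.

(** Each edge is at most [K] times its parameter increment, and the increments telescope. *)
Lemma lipschitz_path_length (K : R) f a b :
  {in `[a, b] &, forall s t, mdist (f s) (f t) <= K * `|s - t|} ->
  (path_length f a b <= (K * (b - a))%:E)%E.
Proof.
move=> fK; apply: ge_ereal_sup => _ [s sab <-]; rewrite lee_fin.
have {fK} : {in `[a, b] &, forall s t, s <= t -> mdist (f s) (f t) <= K * (t - s)}.
  by move=> u v uab vab uv; rewrite (le_trans (fK _ _ uab vab))// distrC ger0_norm// subr_ge0.
elim: s a sab => [|c s IH] a sab fK.
  by rewrite polygonal_length_nil (itv_partition_nil sab) subrr mulr0.
have cb := itv_partition_le (itv_partition_cons sab).
have ac : a <= c by case: sab => /= /andP[/ltW].
rewrite polygonal_length_cons.
have -> : K * (b - a) = K * (c - a) + K * (b - c) by ring.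
apply: lerD; first by apply: fK => //; rewrite in_itv/= ?lexx ?ac ?cb// (le_trans ac).
apply: IH; first exact: itv_partition_cons sab.
move=> u v /itvP uab /itvP vab; apply: fK; rewrite in_itv/= ?uab ?vab andbT (le_trans ac)//.
  by rewrite uab.
by rewrite vab.
Qed.

End Length.

(** * Distances along Euclidean segments *)

Section EuclideanSegments.
Context {R : realType} {n : nat}.
Implicit Types (u v : 'rV[R]_n) (t : R).

Lemma eucl_dist_sym u v : eucl_dist u v = eucl_dist v u.
Proof. by congr Num.sqrt; apply: eq_bigr => k _; rewrite -sqrrN opprB. Qed.

Lemma eucl_dist_segment u v t :
  0 <= t -> eucl_dist u ((1 - t) *: u + t *: v) = t * eucl_dist u v.
Proof.
move=> t0; rewrite -[in RHS](ger0_norm t0) -sqrtr_sqr -sqrtrM ?sqr_ge0// mulr_sumr.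
by congr Num.sqrt; apply: eq_bigr => k _; rewrite !mxE; ring.
Qed.

Lemma eucl_dist_segmentr u v t :
  t <= 1 -> eucl_dist ((1 - t) *: u + t *: v) v = (1 - t) * eucl_dist u v.
Proof.
move=> t1; rewrite eucl_dist_sym (eucl_dist_sym u).
rewrite -(eucl_dist_segment v u) ?subr_ge0//.
by congr eucl_dist; rewrite addrC; congr (_ *: _ + _); ring.
Qed.

End EuclideanSegments.

(** * Distances between points on the sides of a Euclidean triangle *)

Section Barycentric.
Context {R : realType}.
Implicit Types (s t : R) (i j : 'I_3) (D : 'I_3 -> 'I_3 -> R).

Definition bary t i : 'I_3 -> R :=
  fun k => (1 - t) * (k == i)%:R + t * (k == ordS i)%:R.

(* Points of a Euclidean triangle with side lengths [D] and barycentric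
   coordinates a and b are at squared distance
   - 1/2 sum_(k, l) (a_k - b_k) (a_l - b_l) D_kl ^ 2. *)
Definition side_dist D i j s t : R :=
  Num.sqrt (- (\sum_k \sum_l
    (bary s i k - bary t j k) * (bary s i l - bary t j l) * D k l ^+ 2) / 2).

Lemma sum_bary t i : \sum_k bary t i k = 1.
Proof.
rewrite !big_ord_recl big_ord0 /bary.
by case: i => [[|[|[|//]]] ?]; rewrite -!val_eqE/=; ring.
Qed.

Lemma side_pointE (xb : 'I_3 -> 'rV[R]_2) i t :
  (1 - t) *: xb i + t *: xb (ordS i) = \sum_k bary t i k *: xb k.
Proof.
rewrite /bary; under eq_bigr do rewrite scalerDl -!scalerA.
rewrite big_split/= -!scaler_sumr; congr (_ *: _ + _ *: _); symmetry.
- by rewrite (bigD1 i)//= eqxx scale1r big1 ?addr0// => k /negPf ->; rewrite scale0r.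
- by rewrite (bigD1 (ordS i))//= eqxx scale1r big1 ?addr0// => k /negPf ->; rewrite scale0r.
Qed.

Lemma eucl_dist_side (xb : 'I_3 -> 'rV[R]_2) i j s t :
  eucl_dist ((1 - s) *: xb i + s *: xb (ordS i))
            ((1 - t) *: xb j + t *: xb (ordS j)) =
  side_dist (fun k l => eucl_dist (xb k) (xb l)) i j s t.
Proof.
rewrite /eucl_dist /side_dist; congr Num.sqrt.
under [in RHS]eq_bigr do under eq_bigr do
  rewrite sqr_sqrtr ?(sumr_ge0 _ (fun _ _ => sqr_ge0 _))//.
rewrite !side_pointE.
have := sum_bary s i; have := sum_bary t j.
set l := bary s i; set m := bary t j.
rewrite !big_ord_recl !big_ord0 !mxE.
set m0 := m ord0; set l0 := l ord0.
set m1 := m (lift ord0 ord0); set l1 := l (lift ord0 ord0).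
set m2 := m (lift ord0 _); set l2 := l (lift ord0 _).
rewrite !addr0 => e1 e2.
(* Once the third coordinate is eliminated, so that coordinate differences sum to zero, the claim is
   a polynomial identity in the entries of the vertices. *)
have -> : m2 = 1 - m0 - m1 by rewrite -e1; ring.
have -> : l2 = 1 - l0 - l1 by rewrite -e2; ring.
by field.
Qed.


End Barycentric.

(** * Comparison triangles and Stewart's formula *)

Definition triple (T : Type) (a b c : T) : 'I_3 -> T := fun k => nth a [:: a; b; c] k.

Section MetricTriangles.
Context {R : realType} {X : metricType R}.
Implicit Types (x : 'I_3 -> X) (p q u : X) (s t : R).

Definition mside_dist x := side_dist (fun k l => mdist (x k) (x l)).

(** By Stewart's theorem this is the distance, in a comparison triangle of [p], [q], [u], from the
    vertex for [u] to the point at parameter [t] on the side from [p] to [q]. *)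
Definition stewart p q u t : R :=
  Num.sqrt ((1 - t) * mdist p u ^+ 2 + t * mdist q u ^+ 2
            - t * (1 - t) * mdist p q ^+ 2).

(** Parameter 1 on side 1 of the triangle is the vertex [u], so the distance between sides
    specialises to a cevian. *)
Lemma mside_dist_vertex p q u t :
  mside_dist (triple p q u) 0 1 t 1 = stewart p q u t.
Proof.
congr Num.sqrt; rewrite !big_ord_recl !big_ord0 /bary -!val_eqE/= /triple/=.
rewrite !mdistxx (metric_sym q p) (metric_sym u p) (metric_sym u q).
by field.
Qed.

Lemma comparison_triangle_side_dist x xb i j s t : comparison_triangle x xb ->
  eucl_dist ((1 - s) *: xb i + s *: xb (ordS i))
            ((1 - t) *: xb j + t *: xb (ordS j)) =
  mside_dist x i j s t.
Proof.
move=> xxb; rewrite eucl_dist_side; congr side_dist.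
by do 2!apply: funext => ?; rewrite xxb.
Qed.

(** The first two vertices go to the origin and [(c, 0)]; the third is [(p, q)], with [p] given by
    the law of cosines. *)
Lemma comparison_triangle_exists x :
  exists xb : 'I_3 -> 'rV[R]_2, comparison_triangle x xb.
Proof.
pose a := mdist (x 1) (x (ordS 1)); pose b := mdist (x (ordS 1)) (x 0).
pose c := mdist (x 0) (x 1).
have bac : b <= a + c by rewrite addrC /b /a /c (metric_sym _ (x 0)) metric_triangle.
have cab : c <= b + a.
  by rewrite /b /a (metric_sym _ (x 0)) (metric_sym (x 1)) metric_triangle.
have abc : a <= c + b.
  by rewrite /b (metric_sym _ (x 0)) /c (metric_sym (x 0) (x 1)) metric_triangle.
have a0 : 0 <= a by exact: mdist_ge0.
have b0 : 0 <= b by exact: mdist_ge0.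
have c0 : 0 <= c by exact: mdist_ge0.
pose p := (b ^+ 2 + c ^+ 2 - a ^+ 2) / (2 * c).
(* For [c = 0] the division yields [p = 0], and the equation survives because then [a = b]. *)
have pc : 2 * c * p = b ^+ 2 + c ^+ 2 - a ^+ 2.
  have [c_eq0|cn0] := eqVneq c 0; last by rewrite /p; field.
  have ->: a = b by lra.
  by rewrite c_eq0; ring.
have pb : p ^+ 2 <= b ^+ 2.
  have [c_eq0|cn0] := eqVneq c 0.
    by rewrite /p c_eq0 mulr0 invr0 mulr0 expr0n/= sqr_ge0.
  rewrite -(@ler_pM2l _ (4 * c ^+ 2)); last by rewrite mulr_gt0// exprn_gt0// lt_def cn0.
  have -> : 4 * c ^+ 2 * p ^+ 2 = (2 * c * p) ^+ 2 by ring.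
  rewrite pc -subr_ge0.
  (* Heron's factorisation: each factor is nonnegative by a triangle inequality. *)
  have -> : 4 * c ^+ 2 * b ^+ 2 - (b ^+ 2 + c ^+ 2 - a ^+ 2) ^+ 2 =
     ((a + c - b) * (b + a - c)) * ((c + b - a) * (a + b + c)) by ring.
  by do !apply: mulr_ge0; lra.
pose pt (y z : R) : 'rV[R]_2 := \row_k (if k == 0 then y else z).
have dpt y z y' z' :
    eucl_dist (pt y z) (pt y' z') = Num.sqrt ((y - y') ^+ 2 + (z - z') ^+ 2).
  by rewrite /eucl_dist !big_ord_recl big_ord0 !mxE/= addr0.
pose q := Num.sqrt (b ^+ 2 - p ^+ 2).
have q2 : q ^+ 2 = b ^+ 2 - p ^+ 2 by rewrite sqr_sqrtr// subr_ge0.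
exists (triple (pt 0 0) (pt c 0) (pt p q)).
have e01 : eucl_dist (pt 0 0) (pt c 0) = c.
  by rewrite dpt -[RHS]ger0_norm// -sqrtr_sqr; congr Num.sqrt; ring.
have e12 : eucl_dist (pt c 0) (pt p q) = a.
  rewrite dpt -[RHS]ger0_norm// -sqrtr_sqr; congr Num.sqrt.
  rewrite !sub0r sqrrN q2 sqrrB; move: pc; lra.
have e20 : eucl_dist (pt 0 0) (pt p q) = b.
  rewrite dpt -[RHS]ger0_norm// -sqrtr_sqr; congr Num.sqrt.
  by rewrite !sub0r !sqrrN q2; ring.
have exx n (y : 'rV[R]_n) : eucl_dist y y = 0.
  by rewrite /eucl_dist big1 ?sqrtr0// => k _; rewrite subrr expr0n.
have xE k : x k = triple (x 0) (x 1) (x (ordS 1)) k.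
  by case: k => [[|[|[|//]]] ?]; congr x; exact: val_inj.
move=> i j; rewrite (xE i) (xE j).
case: i j => [[|[|[|//]]] ?] [[|[|[|//]]] ?]; rewrite /triple/= ?exx ?mdistxx//.
- by rewrite e20 [LHS]metric_sym.
- by rewrite (eucl_dist_sym (pt c 0)) e01 metric_sym.
- by rewrite (eucl_dist_sym (pt p q)) e20.
- by rewrite (eucl_dist_sym (pt p q)) e12 metric_sym.
Qed.

(** The numbers [l1] and [l2] exceed the exact parts [t * c] and [(1 - t) * c] of the side by [al]
    and [be], whose sum is at most [h]; Stewart's expression only sees these excesses. *)
Lemma stewart_le p q u t (l1 l2 h : R) : 0 <= t <= 1 -> 0 <= h ->
  mdist p u <= l1 -> mdist q u <= l2 ->
  t * mdist p q <= l1 -> (1 - t) * mdist p q <= l2 ->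
  l1 + l2 <= mdist p q + h ->
  stewart p q u t <= Num.sqrt (mdist p q * h / 2 + h ^+ 2).
Proof.
move=> /andP[t0 t1] h0 pu qu; rewrite /stewart.
move: (mdist_ge0 p u) (mdist_ge0 q u) (mdist_ge0 p q).
set a := mdist p u in pu *; set b := mdist q u in qu *; set c := mdist p q.
move=> a0 b0 c0 tl1 tl2 ll; apply: ler_wsqrtr.
have a2 : (1 - t) * a ^+ 2 <= (1 - t) * l1 ^+ 2.
  by rewrite ler_wpM2l ?subr_ge0// lerXn2r ?nnegrE//; lra.
have b2 : t * b ^+ 2 <= t * l2 ^+ 2.
  by rewrite ler_wpM2l// lerXn2r ?nnegrE//; lra.
pose al := l1 - t * c; pose be := l2 - (1 - t) * c.
have al0 : 0 <= al by rewrite subr_ge0.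
have be0 : 0 <= be by rewrite subr_ge0.
have abh : al + be <= h by rewrite /al /be; lra.
(* All terms in [c ^+ 2] cancel; the cross term has coefficient [2 * (t * (1 - t))], at most 1/2. *)
have : (1 - t) * l1 ^+ 2 + t * l2 ^+ 2 - t * (1 - t) * c ^+ 2 =
  2 * (t * (1 - t)) * c * (al + be) + (1 - t) * al ^+ 2 + t * be ^+ 2.
  by rewrite /al /be; ring.
have t4 : 2 * (t * (1 - t)) <= 2^-1 by have := sqr_ge0 (2 * t - 1); lra.
have tt0 : 0 <= 2 * (t * (1 - t)) by rewrite !mulr_ge0// subr_ge0.
have : 2 * (t * (1 - t)) * c * (al + be) <= 2^-1 * c * h.
  by apply: ler_pM => //; [exact: mulr_ge0|exact: addr_ge0|exact: ler_wpM2r].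
have alh : (1 - t) * al ^+ 2 <= (1 - t) * h ^+ 2.
  by rewrite ler_wpM2l ?subr_ge0// lerXn2r ?nnegrE//; lra.
have beh : t * be ^+ 2 <= t * h ^+ 2.
  by rewrite ler_wpM2l// lerXn2r ?nnegrE//; lra.
lra.
Qed.

End MetricTriangles.

(** * The five-point condition and its relation to rough CAT(0) *)

Section FivePoint.
Context {R : realType}.
Implicit Types (X : metricType R) (C : R).

(* [u] and [v] are compared with the points of parameters [s] and [t] on the
   sides [i] and [j] of the comparison triangle; the two [stewart] terms measure
   how far [u] and [v] are from lying on these sides. *)
Definition five_point C X := forall (x : 'I_3 -> X) (i j : 'I_3) (s t : R) (u v : X),
  i != j -> s \in `[0, 1] -> t \in `[0, 1] ->
  mdist u v <= C + mside_dist x i j s t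
    + stewart (x i) (x (ordS i)) u s + stewart (x j) (x (ordS j)) v t.

Lemma triangle_shortness_gt0 X (x : 'I_3 -> X) : 0 < triangle_shortness x.
Proof.
by rewrite invr_gt0 (lt_le_trans ltr01)// bigmax_ge_id.
Qed.

Lemma triangle_shortness_le1 X (x : 'I_3 -> X) : triangle_shortness x <= 1.
Proof.
by rewrite invf_le1 ?bigmax_ge_id// (lt_le_trans ltr01)// bigmax_ge_id.
Qed.

Lemma mdist_mul_triangle_shortness X (x : 'I_3 -> X) i :
  mdist (x i) (x (ordS i)) * triangle_shortness x <= 1.
Proof.
rewrite ler_pdivrMr ?mul1r; first exact: le_bigmax.
by rewrite (lt_le_trans ltr01)// bigmax_ge_id.
Qed.

(** Lengths dominate distances, so a point placed by its distance to one end meets both length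
    conditions, the second by the triangle inequality. *)
Lemma comparison_point_segment X (x : 'I_3 -> X) g xb i a s h :
  short_triangle h x g -> comparison_triangle x xb ->
  a \in `[0, curve_end (g i)] -> s \in `[0, 1] ->
  mdist (x i) (g i a) = s * mdist (x i) (x (ordS i)) ->
  comparison_point g xb i a ((1 - s) *: xb i + s *: xb (ordS i)).
Proof.
move=> /(_ i) [_ [gi0 gi1]] xxb; rewrite !in_itv/= => /andP[a0 aL] /andP[s0 s1] ds.
split.
- by exists s => //=; rewrite in_itv/= s0.
- rewrite eucl_dist_segment// xxb -ds -gi0.
  exact: mdist_le_path_length.
- rewrite eucl_dist_segmentr// xxb; apply: le_trans (mdist_le_path_length _ aL).
  rewrite lee_fin gi1; have := metric_triangle (x i) (g i a) (x (ordS i)).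
  by rewrite ds; lra.
Qed.

Lemma rCAT0_side_points C X (x : 'I_3 -> X) g i j a b s t : rCAT0 C X ->
  short_triangle (triangle_shortness x) x g -> i != j ->
  a \in `[0, curve_end (g i)] -> b \in `[0, curve_end (g j)] ->
  s \in `[0, 1] -> t \in `[0, 1] ->
  mdist (x i) (g i a) = s * mdist (x i) (x (ordS i)) ->
  mdist (x j) (g j b) = t * mdist (x j) (x (ordS j)) ->
  mdist (g i a) (g j b) <= mside_dist x i j s t + C.
Proof.
move=> [_ XC] gx ij ai bj s01 t01 ds dt.
have [xb xxb] := comparison_triangle_exists x.
rewrite -(comparison_triangle_side_dist _ _ _ _ xxb).
apply: (XC x g xb) => //.
  exact: comparison_point_segment gx xxb ai s01 ds.
exact: comparison_point_segment gx xxb bj t01 dt.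
Qed.

(** The curve [g] is completed to a triangle with apex [u] by two short segments; [u] is taken as
    the end of side 1. *)
Lemma rCAT0_opposite_vertex C X (p q u : X) (g : curve X) h a s : rCAT0 C X ->
  short h g -> joins g p q -> h <= triangle_shortness (triple p q u) ->
  a \in `[0, curve_end g] -> s \in `[0, 1] ->
  mdist p (g a) = s * mdist p q ->
  mdist (g a) u <= stewart p q u s + C.
Proof.
move=> XC gh gpq hT ag s01 ds; have [XL _] := XC.
have T0 := triangle_shortness_gt0 (triple p q u).
have [g1 [g1h g1j]] := XL q u _ T0; have [g2 [g2h g2j]] := XL u p _ T0.
rewrite -mside_dist_vertex; have [_ g1u] := g1j; rewrite -{1}g1u.
have gT : short_triangle (triangle_shortness (triple p q u)) (triple p q u)
    (triple g g1 g2).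
  by case=> [[|[|[|//]]] ?]; split => //; exact: short_le gh.
apply: (rCAT0_side_points (i := 0) (j := 1) XC gT) => //=.
- by rewrite in_itv/= curve_end_ge0 lexx.
- by rewrite in_itv/= ler01 lexx.
- by rewrite mul1r /triple/= g1u.
Qed.

(** The path from [u] to [v] runs through one point on each of the two sides, and each of its three
    legs costs one [C]. *)
Lemma rCAT0_five_point C X : rCAT0 C X -> five_point (3 * C) X.
Proof.
move=> XC x i j s t u v ij s01 t01; have [XL _] := XC.
pose hu := triangle_shortness (triple (x i) (x (ordS i)) u).
pose hv := triangle_shortness (triple (x j) (x (ordS j)) v).
(* The same curves must serve as sides of the triangle [x] and of the two thin triangles with apexes
   [u] and [v]. *)
pose h := Num.min (triangle_shortness x) (Num.min hu hv).
have h0 : 0 < h by rewrite !lt_min !triangle_shortness_gt0.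
have /choice[g gh] k := XL (x k) (x (ordS k)) h h0.
have side k r : r \in `[0, 1] -> exists2 a, a \in `[0, curve_end (g k)] &
    mdist (x k) (g k a) = r * mdist (x k) (x (ordS k)).
  rewrite in_itv/= => /andP[r0 r1]; have [_ [<- <-]] := gh k.
  by apply: curve_ivt; rewrite mulr_ge0 ?mdist_ge0//= ler_piMl ?mdist_ge0.
have [a ai da] := side i _ s01; have [b bj db] := side j _ t01.
have gx : short_triangle (triangle_shortness x) x g.
  by move=> k; have [gk ?] := gh k; split=> //; apply: short_le gk; rewrite ge_min lexx.
have dw := rCAT0_side_points XC gx ij ai bj s01 t01 da db.
have [gih gij] := gh i; have [gjh gjj] := gh j.
have hhu : h <= hu by rewrite !ge_min lexx orbT.
have hhv : h <= hv by rewrite !ge_min lexx !orbT.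
have du := rCAT0_opposite_vertex XC gih gij hhu ai s01 da.
have dv := rCAT0_opposite_vertex XC gjh gjj hhv bj t01 db.
have := metric_triangle u (g i a) v; have := metric_triangle (g i a) (g j b) v.
by rewrite (metric_sym u (g i a)); lra.
Qed.

Lemma short_comparison_point X (x : 'I_3 -> X) g xb h i a ub : 0 <= h ->
  short_triangle h x g -> comparison_triangle x xb -> a \in `[0, curve_end (g i)] ->
  comparison_point g xb i a ub ->
  exists s, [/\ s \in `[0, 1], ub = (1 - s) *: xb i + s *: xb (ordS i) &
    stewart (x i) (x (ordS i)) (g i a) s <=
    Num.sqrt (mdist (x i) (x (ordS i)) * h / 2 + h ^+ 2)].
Proof.
move=> h0 /(_ i) [gh [gi0 gi1]] xxb ai [[s s01 <-]].
have := s01; rewrite /= in_itv/= => /andP[s0 s1].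
rewrite eucl_dist_segment// eucl_dist_segmentr// xxb => le1 le2.
exists s; split=> //.
have := ai; rewrite in_itv/= => /andP[a0 aL].
(* Both the true distance and the comparison distance to a vertex are at most the subpath length,
   hence so is their maximum, and [short_split] bounds [l1 + l2]. *)
pose l1 := Num.max (mdist (x i) (g i a)) (s * mdist (x i) (x (ordS i))).
pose l2 := Num.max (mdist (x (ordS i)) (g i a)) ((1 - s) * mdist (x i) (x (ordS i))).
apply: (@stewart_le _ _ _ _ _ _ l1 l2); rewrite ?s0 ?le_max ?lexx ?orbT//.
rewrite -gi0 -gi1; apply: short_split gh ai _ _.
- by rewrite EFin_max ge_max le1 andbT -gi0 mdist_le_path_length.
- by rewrite EFin_max ge_max le2 andbT -gi1 metric_sym mdist_le_path_length.
Qed.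

Lemma five_point_rCAT0 C X : length_space X -> five_point C X ->
  rCAT0 (C + 2 * Num.sqrt 3) X.
Proof.
move=> XL XC; split=> // x g xb i j a b ub vb gx xxb ij ai bj cu cv.
have h0 := ltW (triangle_shortness_gt0 x).
have [s [s01 -> su]] := short_comparison_point h0 gx xxb ai cu.
have [t [t01 -> sv]] := short_comparison_point h0 gx xxb bj cv.
rewrite (comparison_triangle_side_dist _ _ _ _ xxb).
have := XC x i j s t (g i a) (g j b) ij s01 t01.
(* The radicand is at most 1/2 + 1. *)
have sqrt3 k : Num.sqrt (mdist (x k) (x (ordS k)) * triangle_shortness x / 2
    + triangle_shortness x ^+ 2) <= Num.sqrt 3.
  apply: ler_wsqrtr.
  have := mdist_mul_triangle_shortness x k.
  have : triangle_shortness x ^+ 2 <= 1 by rewrite exprn_ile1// triangle_shortness_le1.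
  lra.
have := sqrt3 i; have := sqrt3 j; lra.
Qed.

Lemma five_point_CAT0 X : geodesic_space X -> five_point 0 X -> CAT0 X.
Proof.
move=> XG XC; split=> // x g xb a b ub vb gx xxb ai bj cu cv.
have [s [s01 -> su]] := short_comparison_point (lexx 0) gx xxb ai cu.
have [t [t01 -> sv]] := short_comparison_point (lexx 0) gx xxb bj cv.
rewrite (comparison_triangle_side_dist _ _ _ _ xxb).
have := XC x _ _ s t (g 0 a) (g 2 b) (isT : 0 != 2 :> 'I_3) s01 t01.
(* With [h = 0] both Stewart terms are bounded by 0. *)
move: su sv; rewrite !mulr0 !mul0r expr0n/= addr0 sqrtr0; lra.
Qed.

End FivePoint.

(** * Stability of the five-point condition under limits and rescaling *)

Section FivePointLimit.
Context {R : realType}.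
Implicit Types (X : metricType R) (C : R).

Lemma cvg_sqr (F : set_system nat) {FF : Filter F} (a : nat -> R) (l : R) :
  a n @[n --> F] --> l -> a n ^+ 2 @[n --> F] --> l ^+ 2.
Proof. by move=> al; apply: (cvgM al al). Qed.

Lemma cvg_sqrt (F : set_system nat) {FF : Filter F} (a : nat -> R) (l : R) :
  a n @[n --> F] --> l -> Num.sqrt (a n) @[n --> F] --> Num.sqrt l.
Proof. by apply: continuous_cvg; exact: sqrt_continuous. Qed.

Lemma cvg_side_dist (F : set_system nat) {FF : Filter F}
    (D : nat -> 'I_3 -> 'I_3 -> R) D0 i j s t :
  (forall k l, D n k l @[n --> F] --> D0 k l) ->
  side_dist (D n) i j s t @[n --> F] --> side_dist D0 i j s t.
Proof.
move=> DD; apply: cvg_sqrt; apply: cvgMr_tmp; apply: cvgN.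
apply: cvg_big => [|k _]; first exact: add_continuous.
apply: cvg_big => [|l _]; first exact: add_continuous.
by apply: cvgMl_tmp; exact: cvg_sqr.
Qed.

(** Both sides of the inequality are continuous in finitely many distances, so pointwise convergence
    of distances suffices. The filter is general in order to cover both sequences and
    ultrafilters. *)
Lemma five_point_limit (F : set_system nat) {FF : ProperFilter F}
    (Y : nat -> metricType R) (C_ : nat -> R) C X (f : forall n, X -> Y n) :
  (forall n, five_point (C_ n) (Y n)) -> C_ n @[n --> F] --> C ->
  (forall a b, mdist (f n a) (f n b) @[n --> F] --> mdist a b) ->
  five_point C X.
Proof.
move=> YC C_C fd x i j s t u v ij s01 t01.
have cvg_stewart p q y r :
    stewart (f n p) (f n q) (f n y) r @[n --> F] --> stewart p q y r.
  have scaled a b k : k * mdist (f n a) (f n b) ^+ 2 @[n --> F] -->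
      k * mdist a b ^+ 2 by apply: cvgMl_tmp; apply: cvg_sqr; exact: fd.
  apply: cvg_sqrt; apply: cvgB; last exact: scaled.
  by apply: cvgD; exact: scaled.
have cvg_mside : mside_dist (fun k => f n (x k)) i j s t @[n --> F] -->
    mside_dist x i j s t by exact: cvg_side_dist.
have rhs := cvgD (cvgD (cvgD C_C cvg_mside) (cvg_stewart (x i) (x (ordS i)) u s))
  (cvg_stewart (x j) (x (ordS j)) v t).
apply: ler_cvg_to (fd u v) (rhs _ _ _) _.
by apply: nearW => n; exact: (YC n (fun k => f n (x k))).
Qed.

Lemma mdist_rescaled X (c : {posnum R}) (a b : rescaled c X) :
  mdist a b = c%:num * @mdist R X a b.
Proof. by []. Qed.

(** All radicands are homogeneous of degree 2 in the distances. *)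
Lemma five_point_rescaled C X (c : {posnum R}) :
  five_point C X -> five_point (c%:num * C) (rescaled c X).
Proof.
move=> XC x i j s t u v ij s01 t01.
have sqrtM_c a b : a = c%:num ^+ 2 * b -> Num.sqrt a = c%:num * Num.sqrt b :> R.
  by move=> ->; rewrite sqrtrM ?sqr_ge0// sqrtr_sqr ger0_norm.
have E p q y r : @stewart R (rescaled c X) p q y r = c%:num * @stewart R X p q y r.
  by apply: sqrtM_c; rewrite !mdist_rescaled; ring.
have E' : @mside_dist R (rescaled c X) x i j s t = c%:num * @mside_dist R X x i j s t.
  apply: sqrtM_c; rewrite mulrA mulrN; congr (- _ / _).
  rewrite mulr_sumr; apply: eq_bigr => k _; rewrite mulr_sumr; apply: eq_bigr => l _.
  by rewrite mdist_rescaled; ring.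
rewrite mdist_rescaled !E E' -!mulrDr ler_pM2l//.
exact: XC.
Qed.

End FivePointLimit.

(** * Non-principal ultrafilters on the natural numbers *)

Section Ultrafilters.

Lemma nonprincipal_cvg (w : set_system nat) :
  UltraFilter w -> nonprincipal w -> w --> \oo.
Proof.
move=> wU wn.
have ge_w n : w [set m | (n <= m)%N].
  elim: n => [|n IH]; first exact: filterS filterT.
  (* If [w] contained [[set n]], it would contain the principal filter at [n] and equal it by
     maximality. So each singleton can be removed in turn. *)
  have [wn1|wn1] := in_ultra_setVsetC [set n] wU.
    case: (wn n).
    by apply: (@max_filter _ _ (principal_filter_ultra n)) => A /principal_filterP An;
      apply: filterS wn1 => _ ->.
  apply: filterS (filterI IH wn1) => m [/= nm mn]; rewrite ltn_neqAle nm andbT.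
  by apply/eqP => nm'; exact: mn.
by move=> A [n _ nA]; apply: filterS (ge_w n) => m; exact: nA.
Qed.

End Ultrafilters.

(** * Gromov-Hausdorff limits *)

Section GromovHausdorffLimits.
Context {R : realType}.
Implicit Types (X : metricType R) (C : R).

(** Maps with distortion below 1/(n+1) on [S n] make distances converge, since each point eventually
    lies in [S n]. The sets are the whole space for unpointed limits and growing balls for pointed
    ones. *)
Lemma five_point_approx C X (X_ : nat -> metricType R) (S : nat -> set X) :
  (forall m, five_point C (X_ m)) ->
  (forall a, \forall n \near \oo, S n a) ->
  (forall n (e : R), 0 < e -> exists m (f : X -> X_ m), forall a b, S n a -> S n b ->
    `|mdist (f a) (f b) - mdist a b| < e) ->
  five_point C X.
Proof.
move=> XC SX approx.
have approx1 n : exists mf : {m & X -> X_ m}, forall a b, S n a -> S n b ->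
    `|mdist (projT2 mf a) (projT2 mf b) - mdist a b| < harmonic n.
  have [m [f mf]] := approx n (harmonic n) (harmonic_gt0 n).
  by exists (existT _ m f).
have [mf mfP] := choice approx1.
apply: (five_point_limit (FF := eventually_filter) (f := fun n => projT2 (mf n))
  (C_ := fun=> C)) => [n| |a b].
- exact: XC.
- exact: cvg_cst.
- apply/cvgrPdist_lt => e e0.
  have := @cvg_harmonic R => /cvgrPdist_lt/(_ _ e0).
  apply: filter_app; near=> n.
  rewrite sub0r normrN ger0_norm ?harmonic_ge0// => /(lt_trans _); apply.
  by rewrite distrC; apply: mfP; near: n; exact: SX.
Unshelve. all: by end_near. Qed.

Lemma gh_dist_lt X Y (e : R) : (gh_dist X Y < e%:E)%E ->
  exists f : Y -> X, forall a b, `|mdist (f a) (f b) - mdist a b| < 2 * e.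
Proof.
move=> /ereal_inf_lt[_ [Z [f [g [fi gi ->]]]]].
move=> /ereal_inf_lt[_ [r [r0 _ YX] <-]]; rewrite lte_fin => re.
(* Each point of [Y] is sent to a point of [X] within [r] of it in [Z]; moving both endpoints
   changes a distance by less than [2 * r]. *)
have /choice[F FP] (b : Y) : exists a : X, mdist (f a) (g b) < r.
  have [|_ [a _ <-]] := YX (g b); first by exists b.
  by rewrite ballEmdist; exists a.
exists F => a b; have := FP a; have := FP b.
rewrite -fi -gi; move: (f (F a)) (f (F b)) (g a) (g b) => fa fb ga gb bb aa.
have := metric_triangle fa ga fb; have := metric_triangle ga gb fb.
have := metric_triangle ga fa gb; have := metric_triangle fa fb gb.
rewrite (metric_sym ga fa) (metric_sym gb fb) ltr_norml; lra.
Qed.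

Lemma gh_limit_five_point C X (X_ : nat -> metricType R) :
  (forall m, five_point C (X_ m)) -> gh_limit X_ X -> five_point C X.
Proof.
move=> XC ghX; apply: (five_point_approx (S := fun=> setT) XC) => [a|n e e0].
  exact: nearW.
have e20 : 0 < e / 2 by rewrite divr_gt0.
have [m /= gh_lt] : exists m, (gh_dist (X_ m) X < (e / 2)%:E)%E.
  have : \forall m \near \oo, (gh_dist (X_ m) X < (e / 2)%:E)%E.
    by apply: (ghX (fun y => (y < (e / 2)%:E)%E)); exact: (@nbhs_open_ereal_lt _ 0 (fun=> e / 2)).
  by move=> /filter_ex.
have [f fP] := gh_dist_lt gh_lt; exists m, f => a b _ _.
by rewrite (lt_le_trans (fP a b))// mulrC divfK.
Qed.

Lemma pointed_gh_limit_five_point C X (X_ : nat -> metricType R) p_ (p : X) :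
  (forall m, five_point C (X_ m)) -> @pointed_gh_limit R X_ p_ X p -> five_point C X.
Proof.
move=> XC ghX; apply: (five_point_approx (S := fun n => ball p n%:R) XC) => [a|n e e0].
  near=> n; rewrite ballEmdist/=; near: n; exact: nbhs_infty_gtr.
(* One third pays for the distortion of [f], the other two for moving the two endpoints. The radius
   [n%:R + d] makes the covered ball have radius exactly [n%:R]. *)
pose d := e / 3; have d0 : 0 < d by rewrite divr_gt0.
have r0 : 0 < n%:R + d by rewrite ltr_wpDl.
have [m [f [fp fd fs]]] := filter_ex (ghX _ _ r0 d0); rewrite addrK in fs.
(* [F] is a rough inverse of [f] on that ball, with default value [p_ m] outside. *)
have /choice[F FP] (b : X) : exists a : X_ m, ball p n%:R b ->
    mdist (p_ m) a < n%:R + d /\ mdist (f a) b < d.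
  have [/fs [a]|nb] := pselect (ball p n%:R b); last by exists (p_ m).
  by rewrite !ballEmdist/= => ar ad; exists a.
exists m, F => a b /FP[ar fa] /FP[br fb].
have := fd (F a) (F b); rewrite !ballEmdist/= => /(_ ar br).
have := metric_triangle (f (F a)) a (f (F b)); have := metric_triangle a b (f (F b)).
have := metric_triangle a (f (F a)) b; have := metric_triangle (f (F a)) (f (F b)) b.
rewrite (metric_sym a (f _)) (metric_sym b (f _)) !ltr_norml.
by have : e = 3 * d; [rewrite /d mulrC divfK|lra].
Unshelve. all: by end_near. Qed.

End GromovHausdorffLimits.

(** * Ultralimits *)

Section Ultralimits.
Context {R : realType} (w : set_system nat) (w_ultra : UltraFilter w).

(** The maps into [X_ m] evaluate a representative at index [m]; distances then converge along [w]
    by the definition of the ultralimit metric. *)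
Lemma ultralimit_five_point (X_ : nat -> metricType R) (p_ : forall m, X_ m)
    (C_ : nat -> R) (C : R) (X : metricType R) (f : X -> ultralimit w_ultra p_) :
  (forall m, five_point (C_ m) (X_ m)) -> C_ m @[m --> w] --> C ->
  isometric_embedding f -> five_point C X.
Proof.
move=> XC C_C fi.
apply: (five_point_limit (FF := _) (f := fun m a => repr (f a) m) XC C_C) => a b.
rewrite -fi [mdist (f a) (f b)]/(seq_dist w (repr (f a)) (repr (f b))).
exact: (@seq_dist_is_cvg _ _ w_ultra).
Qed.

End Ultralimits.

(** * Asymptotic cones: geodesics and CAT(0) *)

Section AsymptoticCone.
Context {R : realType}.
Implicit Types (X : metricType R) (h s t : R).

(** The length over [[0, 1]] is at most [K], which is the distance of the endpoints. *)
Lemma lipschitz_geodesic X (f : R -> X) (K : R) :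
  (forall s t, mdist (f s) (f t) <= K * `|s - t|) -> mdist (f 0) (f 1) = K ->
  exists g : curve X, short 0 g /\ joins g (f 0) (f 1).
Proof.
move=> fK f01.
have f_cont : continuous f.
  move=> s; apply/metricType_numDomainType.cvgrPdist_lt => e e0.
  have K0 : 0 <= K by rewrite -f01 mdist_ge0.
  have K1 : 0 < K + 1 by rewrite ltr_wpDl.
  have /cvgrPdist_lt/(_ (e / (K + 1))) : id @ s --> s by exact: cvg_id.
  rewrite divr_gt0// => /(_ isT); apply: filterS => t.
  rewrite ltr_pdivlMr// mulrC; apply: le_lt_trans; apply: le_trans (fK s t) _.
  by rewrite ler_wpM2r// lerDl.
pose g := Curve ler01 (continuous_subspaceT f_cont); exists g; split=> //.
have le1 : (curve_length g <= K%:E)%E.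
  have -> : K = K * (1 - 0) by rewrite subr0 mulr1.
  by apply: lipschitz_path_length => s t _ _; exact: fK.
rewrite /short sube0 /= f01 le1/= -f01.
exact: mdist_le_path_length.
Qed.

(* The parameters chosen on the short curve need not be increasing, but points
   taken in the wrong order are at distance at most [h]. *)
Lemma rough_geodesic X (x y : X) h : length_space X -> 0 < h ->
  exists z : R -> X, [/\
    forall t, t \in `[0, 1] -> mdist x (z t) = t * mdist x y,
    forall s t, s \in `[0, 1] -> t \in `[0, 1] ->
      mdist (z s) (z t) <= mdist x y * `|s - t| + h &
    mdist (z 1) y <= h].
Proof.
move=> XL h0; have [g [gh [g0 g1]]] := XL x y h h0.
have /choice[a aP] t : exists a, t \in `[0, 1] -> a \in `[0, curve_end g] /\
    mdist x (g a) = t * mdist x y.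
  have [t01|_] := boolP (t \in `[0, 1]); last by exists 0.
  have : 0 <= t * mdist (g 0) (g (curve_end g)) <= mdist (g 0) (g (curve_end g)).
    by move: t01; rewrite in_itv/= => /andP[t0 t1]; rewrite mulr_ge0 ?ler_piMl ?mdist_ge0.
  by move=> /curve_ivt[b bg]; rewrite g0 g1; exists b.
exists (g \o a); split => [t /aP[]//|s t|].
- wlog st : s t / a s <= a t => [wl s01 t01|s01 t01].
    have [/wl|/ltW/wl] := leP (a s) (a t); first exact.
    by rewrite metric_sym distrC; exact.
  have [+ ds] := aP s s01; rewrite in_itv/= => /andP[s0 _].
  have [+ dt] := aP t t01; rewrite in_itv/= => /andP[_ tL].
  (* Together with the triangle inequality through [z t], this bounds the distance by
     [(t - s) * mdist x y + h], whatever the order of [s] and [t]. *)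
  have := short_mdist3 gh s0 st tL; rewrite g0 g1 ds => le3.
  have := metric_triangle x (g (a t)) y; rewrite dt => le2.
  have : mdist x y * (t - s) <= mdist x y * `|s - t|.
    by rewrite ler_wpM2l ?mdist_ge0// distrC ler_norm.
  rewrite /=; lra.
- have one01 : (1 : R) \in `[0, 1] by rewrite in_itv/= ler01 lexx.
  have [+ d1] := aP 1 one01; rewrite in_itv/= => /andP[a0 aL].
  have := short_mdist3 gh (lexx 0) a0 aL; rewrite mdistxx g0 g1 d1 /=; lra.
Qed.

(** The 1-Lipschitz retraction onto [[0, 1]]: it extends a path on [[0, 1]] to the whole line, as
    [lipschitz_geodesic] requires. *)
Definition clamp t : R := Num.max 0 (Num.min 1 t).

Lemma clamp01 t : clamp t \in `[0, 1].
Proof. by rewrite in_itv/= le_max lexx/= ge_max ler01 ge_min lexx. Qed.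

Lemma clamp_lipschitz s t : `|clamp s - clamp t| <= `|s - t|.
Proof.
have := ler_norm (t - s); have := ler_norm (s - t); rewrite (distrC t s) ler_norml.
rewrite /clamp; case: (leP 1 s) => ?; case: (leP 1 t) => ?; do ?case: (leP 0 _) => ?; lra.
Qed.

Lemma cvg_cone_scale (w : set_system nat) : UltraFilter w -> nonprincipal w ->
  (@cone_scale R m)%:num @[m --> w] --> 0.
Proof.
move=> w_ultra w_np; have w_oo := nonprincipal_cvg w_ultra w_np.
suff : (((maxn m 1)%:R : R)^-1 : R) @[m --> \oo] --> (0 : R).
  by apply: cvg_trans; exact: cvg_app.
apply/cvgrPdist_lt => e e0; near=> m.
have me : e^-1 < (maxn m 1)%:R.
  apply: (@lt_le_trans _ _ m%:R); last by rewrite ler_nat leq_maxl.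
  by near: m; exact: nbhs_infty_gtr.
rewrite sub0r normrN gtr0_norm//= -[e]invrK ltf_pV2 ?posrE ?invr_gt0.
Unshelve. all: by end_near. Qed.

Lemma ultralimit_dist_le (w : set_system nat) (w_ultra : UltraFilter w)
    (X_ : nat -> metricType R) (p : forall m, X_ m) (u v : bounded_seq p)
    (d : nat -> R) (l : R) :
  (forall m, mdist (u m) (v m) <= d m) -> d m @[m --> w] --> l ->
  mdist (\pi_(ultralimit w_ultra p) u)%qT (\pi_(ultralimit w_ultra p) v)%qT <= l.
Proof.
move=> uvd dl; rewrite ultralimit_distE.
have uv : cvg (mdist (u m) (v m) @[m --> w]) by exact: (seq_dist_is_cvg w_ultra).
by apply: ler_cvg_to uv dl _; exact: nearW.
Qed.

(** Rough geodesics with fixed error 1 join representatives of the endpoints; the scaling sends this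
    error to 0, so their ultralimit is a geodesic. *)
Lemma asymptotic_cone_geodesic X (w : set_system nat) (w_ultra : UltraFilter w)
    (p : X) : length_space X -> nonprincipal w ->
  geodesic_space (asymptotic_cone w_ultra p).
Proof.
move=> XL w_np x y.
have c0 := cvg_cone_scale w_ultra w_np.
pose c m : R := (cone_scale m)%:num.
have c_ge0 m : 0 <= c m by rewrite /c.
pose xs := repr x; pose ys := repr y.
pose D m : R := @mdist R X (xs m) (ys m).
have [z zP] := choice (fun m => rough_geodesic (xs m : X) (ys m : X) XL ltr01).
have /choice[b bz] t : exists b : bounded_seq (X_ := fun m => rescaled (cone_scale m) X) (fun=> p),
    forall m, b m = z m (clamp t).
  have [B xB] := bseq_bounded xs; have [B' yB'] := bseq_bounded ys.
  suff bnd : exists B, forall m, @mdist R (rescaled (cone_scale m) X) (z m (clamp t)) p <= B.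
    by exists (BoundedSeq bnd).
  (* A point [z] lies within [D m] of [xs m], and [D m] is at most the sum of the distances of
     [xs m] and [ys m] to [p]; so the distance to [p] from [xs m] counts twice. *)
  exists (2 * B + B') => m; have := xB m; have := yB' m.
  rewrite !mdist_rescaled; have [/(_ _ (clamp01 t)) xz _ _] := zP m.
  have := clamp01 t; rewrite in_itv/= => /andP[t0 t1].
  have tD : clamp t * D m <= D m by rewrite ler_piMl ?mdist_ge0.
  have := @metric_triangle R X (z m (clamp t)) (xs m) p.
  rewrite (@metric_sym R X (z m _) (xs m)) xz.
  have := @metric_triangle R X (xs m) p (ys m); rewrite (@metric_sym R X p (ys m)).
  rewrite -/(D m) => le1 le2.
  have : c m * @mdist R X (z m (clamp t)) p <=
      c m * (2 * @mdist R X (xs m) p + @mdist R X (ys m) p).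
    by rewrite ler_wpM2l//; lra.
  rewrite mulrDr mulrCA -/(c m); lra.
pose f t : asymptotic_cone w_ultra p := 
  (\pi_(@ultralimit R w w_ultra (fun m => rescaled (cone_scale m) X) (fun=> p)) (b t))%qT.
have cD : c m * D m @[m --> w] --> mdist x y.
  exact: (@seq_dist_is_cvg _ _ w_ultra _ _ xs ys).
have clamp0 : clamp 0 = 0 by rewrite /clamp min_r ?ler01// maxxx.
have clamp1 : clamp 1 = 1 by rewrite /clamp minxx max_r.
have fx : f 0 = x.
  apply: mdist_positivity; apply/eqP; rewrite eq_le mdist_ge0 andbT.
  rewrite -[x in mdist _ x]reprK.
  apply: (ultralimit_dist_le w_ultra (d := fun=> 0)); last exact: cvg_cst.
  move=> m; rewrite mdist_rescaled bz clamp0 -/xs.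
  have [/(_ 0) xz _ _] := zP m.
  by rewrite (@metric_sym R X) xz ?mul0r ?mulr0// in_itv/= lexx ler01.
have fy : f 1 = y.
  apply: mdist_positivity; apply/eqP; rewrite eq_le mdist_ge0 andbT.
  rewrite -[y in mdist _ y]reprK.
  apply: (ultralimit_dist_le w_ultra (d := c)); last exact: c0.
  move=> m; rewrite mdist_rescaled bz clamp1 -/ys.
  by have [_ _ zy] := zP m; rewrite -[leRHS]mulr1 ler_wpM2l.
rewrite -fx -fy; apply: (@lipschitz_geodesic _ f (mdist x y)); last by rewrite fx fy.
move=> s t; apply: le_trans (_ : mdist x y * `|clamp s - clamp t| <= _); last first.
  by rewrite ler_wpM2l ?mdist_ge0 ?clamp_lipschitz.
(* This is the rough geodesic estimate multiplied by [c m]; its additive error 1 has become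
   [c m]. *)
apply: (ultralimit_dist_le w_ultra (d := fun m => c m * D m * `|clamp s - clamp t| + c m)).
  move=> m; rewrite mdist_rescaled !bz -/(c m) -mulrA -[X in _ + X]mulr1 -mulrDr.
  by rewrite ler_wpM2l//; have [_ zz _] := zP m; apply: zz; exact: clamp01.
rewrite -[X in _ --> X]addr0; apply: cvgD; last exact: c0.
by apply: cvgMr_tmp.
Qed.

(** The rescaled spaces satisfy the five-point condition with constants tending to 0, so the cone
    satisfies it with constant 0. *)
Lemma asymptotic_cone_CAT0 C X (w : set_system nat) (w_ultra : UltraFilter w)
    (p : X) : rCAT0 C X -> nonprincipal w -> CAT0 (asymptotic_cone w_ultra p).
Proof.
move=> XC w_np; have [XL _] := XC.
apply: five_point_CAT0; first exact: asymptotic_cone_geodesic.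
have X5 := rCAT0_five_point XC.
apply: (@ultralimit_five_point _ w w_ultra (fun m => rescaled (cone_scale m) X)
  (fun=> p) (fun m => (cone_scale m)%:num * (3 * C)) 0 _ id) => //.
  by move=> m; exact: five_point_rescaled.
rewrite -[X in _ --> X](mul0r (3 * C)).
by apply: cvgMr_tmp; exact: cvg_cone_scale.
Qed.

End AsymptoticCone.

Theorem corollary4p17 (R : realType) (C : R) (X : metricType R)
    (X_ : nat -> metricType R) (C_gt0 : 0 < C) (X_length : length_space X)
    (X_rCAT0 : forall m, rCAT0 C (X_ m)) :
  let Ct : R := 3 * C + 2 * Num.sqrt 3 in
  [/\ (gh_limit X_ X \/
       exists (p_ : forall m, X_ m) (p : X), pointed_gh_limit p_ p) ->
      rCAT0 Ct X,
      (exists (w : set_system nat) (w_ultra : UltraFilter w)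
              (p_ : forall m, X_ m),
         nonprincipal w /\ isometric X (ultralimit w_ultra p_)) ->
      rCAT0 Ct X
    &
      (exists2 C1 : R, 0 < C1 & rCAT0 C1 X) ->
      forall (w : set_system nat) (w_ultra : UltraFilter w), nonprincipal w ->
      forall p : X, CAT0 (asymptotic_cone w_ultra p)].
Proof.
move=> Ct; have X5 m := rCAT0_five_point (X_rCAT0 m); split.
- move=> ghX; apply: five_point_rCAT0 => //.
  case: ghX => [|[p_ [p]]]; first exact: gh_limit_five_point.
  exact: pointed_gh_limit_five_point.
- move=> [w [w_ultra [p_ [_ [f [fi _]]]]]]; apply: five_point_rCAT0 => //.
  by apply: (ultralimit_five_point (C_ := fun=> 3 * C) X5 _ fi); exact: cvg_cst.
- move=> [C1 _ XC] w w_ultra w_np p; exact: asymptotic_cone_CAT0 XC w_np.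
Qed.
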